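(* Let $\mathbb{K}$ be a countably infinite field. Every diagonalizable $\mathbb{K}^*$-representation admits a reduced model.
   Context: Let $U$ be a countable, discrete (possibly infinite-dimensional) vector space over $\mathbb{K}$ and $\rho_U:\mathbb{K}^*\to\operatorname{GL}(U)$ a linear representation. $(U,\rho_U)$ is diagonalizable if there are linear subspaces $U_1,\ldots,U_r\leq U$ (the weight spaces) and distinct integers $m_1,\ldots,m_r$ (the weights) such that $U = U_1\oplus\cdots\oplus U_r$ and $\rho_U(a)u_i = a^{m_i}u_i$ for all $a\in\mathbb{K}^*$, $u_i\in U_i$, $i=1,\ldots,r$. A diagonalizable representation is reduced if none of its weights is divisible by the characteristic of $\mathbb{K}$; if $\operatorname{char}(\mathbb{K})=0$, every diagonalizable representation is regarded as reduced. A reduced model of $(U,\rho_U)$ is a triple $(V,\rho_V,\Phi)$ where $(V,\rho_V)$ is a reduced diagonalizable $\mathbb{K}^*$-representation and $\Phi:V\to U$ is an isomorphism of the additive groups $(V,+)$ and $(U,+)$ (not necessarily $\mathbb{K}$-linear) with $\Phi\circ\rho_V(a)=\rho_U(a)\circ\Phi$ for all $a\in\mathbb{K}^*$.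
   Formalization: In positive characteristic p, ''reduced'' is taken to mean that no nonzero weight is divisible by p; weight 0 is allowed, since otherwise the trivial representation on K would have no reduced model. *)

(* Defs.v *)
From HB Require Import structures.
From mathcomp Require Import all_boot all_order all_algebra.
From mathcomp Require Import classical_sets functions cardinality.

Set Implicit Arguments.
Unset Strict Implicit.
Unset Printing Implicit Defensive.

Import GRing.Theory.
Local Open Scope ring_scope.

(* Group morphisms K^* -> GL(U).  The value of [rep_fun] at 0 is a junk value
   that is never used.  For a != 0 the two laws make [rep_fun a] invertible,
   with inverse [rep_fun a^-1]. *)
Record kstar_rep (K : fieldType) (U : lmodType K) := KstarRep {
  rep_fun :> K -> {linear U -> U};
  rep_one : forall u, rep_fun 1 u = u;
  rep_mul : forall a b, a != 0 -> b != 0 ->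
    forall u, rep_fun (a * b) u = rep_fun a (rep_fun b u) }.

(* U = W_0 (+) ... (+) W_(r-1), with K^* acting on W_i through the character
   a |-> a ^ m_i.  Linear subspaces are boolean predicates; classically this is
   no restriction. *)
Definition weight_decomposition (K : fieldType) (U : lmodType K)
    (rho : kstar_rep U) (r : nat) (W : 'I_r -> submodClosed U)
    (m : 'I_r -> int) : Prop :=
  [/\ injective m,
      forall u : U, exists! w : {ffun 'I_r -> U},
        (forall i, w i \in W i) /\ u = \sum_i w i
    & forall (a : K) (i : 'I_r) (u : U),
        a != 0 -> u \in W i -> rho a u = (a ^ m i) *: u].

Definition diagonalizable_rep (K : fieldType) (U : lmodType K)
    (rho : kstar_rep U) : Prop :=
  exists (r : nat) (W : 'I_r -> submodClosed U) (m : 'I_r -> int),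
    weight_decomposition rho W m.

(* [pchar K] is empty in characteristic 0, so that every weight is reduced.
   The weight 0 is always allowed, although it is formally divisible by p: over
   an infinite field a trivial representation is isomorphic, even additively,
   to trivial representations only, hence could never acquire nonzero weights.
*)
Definition reduced_weight (K : fieldType) (m : int) : Prop :=
  forall p : nat, p \in [pchar K] -> m != 0 -> ~~ (p%:Z %| m)%Z.

(* Null weight spaces are not excluded: they can be dropped from a
   decomposition, so the existence of a decomposition with reduced weights does
   not depend on this choice. *)
Definition reduced_rep (K : fieldType) (U : lmodType K)
    (rho : kstar_rep U) : Prop :=
  exists (r : nat) (W : 'I_r -> submodClosed U) (m : 'I_r -> int),
    weight_decomposition rho W m /\ (forall i, reduced_weight K (m i)).

Definition reduced_model (K : fieldType) (U : lmodType K) (rhoU : kstar_rep U)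
    (V : lmodType K) (rhoV : kstar_rep V) (Phi : {additive V -> U}) : Prop :=
  [/\ countable [set: V],
      reduced_rep rhoV,
      bijective Phi
    & forall (a : K) (v : V), a != 0 -> Phi (rhoV a v) = rhoU a (Phi v)].

(* Main.v *)
Require Import Defs.
From HB Require Import structures.
From mathcomp Require Import all_boot all_order all_algebra.
From mathcomp Require Import boolp classical_sets functions cardinality.

Set Implicit Arguments.
Unset Strict Implicit.
Unset Printing Implicit Defensive.

Import GRing.Theory.
Local Open Scope ring_scope.

(** Only positive characteristic p needs an idea.  There every nonzero weight m
    is n * p ^ k with p not dividing n, so that a ^ m = f (a ^ n), where f is
    the k-th power of the Frobenius endomorphism of K.  On the weight space U_m,
    let K act by restriction of scalars along f, that is c . u := f c *: u.
    This is another vector space structure on the same additive group, and for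
    it K^* acts on U_m through a |-> a ^ n, which is a reduced character.
    Restriction of scalars along a field endomorphism needs no surjectivity, so
    K may be imperfect.

    Doing this on all the weight spaces at once, each with its own f_i, gives
    V: the group U with the scalar multiplication c . u = sum_i f_i c *: P_i u,
    where P_i projects U onto its i-th weight space.  The identity map V -> U
    is then the required equivariant isomorphism of additive groups.

    Distinct weights of U, such as 1 and p, may have the same reduced part, and
    the corresponding weight spaces have to be added up to obtain a weight
    decomposition of V with distinct weights ([merge_projections]).

    Decompositions are handled through their projections, because those are
    maps on the common additive group and remain linear after the change of
    scalars.  The two facts that carry the proof are [character_factorization]
    and [twist_scale_proj]. *)

(** * Direct sum decompositions as systems of projections *)

Definition projection_system (K : fieldType) (U : lmodType K) (I : finType)
    (P : I -> {linear U -> U}) : Prop :=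
  (forall u, \sum_i P i u = u) /\
  (forall i j u, P i (P j u) = if i == j then P j u else 0).

Lemma projection_sum (K : fieldType) (U : lmodType K) (I : finType)
    (P : I -> {linear U -> U}) (hP : projection_system P) (w : I -> U) i :
  P i (\sum_j P j (w j)) = P i (w i).
Proof.
rewrite raddf_sum (bigD1 i) //= hP.2 eqxx big1 ?addr0 // => j ji.
by rewrite hP.2 eq_sym (negPf ji).
Qed.

Lemma projections_of_weight_decomposition (K : fieldType) (U : lmodType K)
    (rho : kstar_rep U) r (W : 'I_r -> submodClosed U) (m : 'I_r -> int) :
  weight_decomposition rho W m ->
  exists P : 'I_r -> {linear U -> U}, projection_system P /\
    forall a u, a != 0 -> rho a u = \sum_i a ^ m i *: P i u.
Proof.
case=> _ dec rhoW.
have [w hw] := choice (fun u => let: ex_intro w h := dec u in ex_intro _ w h).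
have wW u i : w u i \in W i by have [[]] := hw u.
have wE u : \sum_i w u i = u by have [[_ <-]] := hw u.
have w_uniq u (v : 'I_r -> U) :
    (forall i, v i \in W i) -> u = \sum_i v i -> forall i, w u i = v i.
  move=> vW vE i; have [_ /(_ (finfun v))-> //] := hw u; first by rewrite ffunE.
  by split=> [j|]; rewrite ?ffunE // vE; apply: eq_bigr => j _; rewrite ffunE.
have wlin i : linear (fun u => w u i).
  move=> c u v; apply: (w_uniq _ (fun j => c *: w u j + w v j)) => [j|].
    by rewrite rpredD ?rpredZ.
  by rewrite big_split /= -scaler_sumr !wE.
exists (fun i => HB.pack_for {linear U -> U} (fun u => w u i)
   (GRing.isLinear.Build K U U *:%R (fun u => w u i) (wlin i))).
split; first split=> [u|i j u] /=; first exact: wE.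
  apply: (w_uniq _ (fun i => if i == j then w u j else 0)) => [k|].
    by case: eqP => [->|_]; rewrite ?rpred0.
  by rewrite -big_mkcond big_pred1_eq.
move=> a u a0; rewrite -[in LHS](wE u) raddf_sum.
by apply: eq_bigr => i _; apply: rhoW.
Qed.

(** The weight spaces are the fixed spaces of the projections. *)
Lemma weight_decomposition_of_projections (K : fieldType) (V : lmodType K)
    (rho : kstar_rep V) r (P : 'I_r -> {linear V -> V}) (m : 'I_r -> int) :
  injective m -> projection_system P ->
  (forall a v, a != 0 -> rho a v = \sum_i a ^ m i *: P i v) ->
  exists W : 'I_r -> submodClosed V, weight_decomposition rho W m.
Proof.
move=> m_inj hP rhoE.
have fixC i : submod_closed (fun v => P i v == v).
  split=> [|c u v]; rewrite !unfold_in ?raddf0 // linearP.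
  by move=> /eqP-> /eqP->.
exists (fun i => HB.pack_for (submodClosed V) (fun v => P i v == v)
  (GRing.isSubmodClosed.Build K V (fun v => P i v == v) (fixC i))).
split=> // [v|a i v a0 /eqP <-].
  exists [ffun i => P i v]; split.
    split=> [i|]; first by rewrite unfold_in /= ffunE hP.2 eqxx.
    by under eq_bigr do rewrite ffunE; rewrite hP.1.
  move=> w [/= wW ->]; apply/ffunP=> i; rewrite ffunE.
  under eq_bigr => j _ do rewrite -(eqP (wW j)).
  by rewrite projection_sum //; apply/eqP/wW.
rewrite rhoE // (bigD1 i) //= hP.2 eqxx big1 ?addr0 // => j ji.
by rewrite hP.2 (negPf ji) scaler0.
Qed.

(** Projections attached to the same integer are added up.  The last clause is
    stated for an arbitrary [c] rather than for the powers of one scalar, so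
    that a single merged system serves all elements of K^*. *)
Lemma merge_projections (K : fieldType) (V : lmodType K) r
    (P : 'I_r -> {linear V -> V}) (n : 'I_r -> int) :
  projection_system P ->
  exists s (Q : 'I_s -> {linear V -> V}) (m : 'I_s -> int),
    [/\ injective m, projection_system Q, forall j, exists i, m j = n i &
      forall (c : int -> K) v, \sum_i c (n i) *: P i v = \sum_j c (m j) *: Q j v].
Proof.
move=> hP; pose s := undup (codom n); pose m (j : 'I_(size s)) := tnth (in_tuple s) j.
have m_inj : injective m by apply/tuple_uniqP; exact: undup_uniq.
have mP i : exists j, m j = n i.
  have : n i \in in_tuple s by rewrite mem_undup codom_f.
  by case/tnthP => j ->; exists j.
pose q j v := \sum_(i | n i == m j) P i v.
have qlin j : linear (q j).
  move=> c u v; rewrite /q scaler_sumr -big_split /=.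
  by apply: eq_bigr => i _; rewrite linearP.
have split_n (F : 'I_r -> V) : \sum_i F i = \sum_j \sum_(i | n i == m j) F i.
  rewrite (exchange_big_dep xpredT) //=; apply: eq_bigr => i _.
  have [j <-] := mP i; rewrite (big_pred1 j) // => k /=.
  by rewrite (inj_eq m_inj) eq_sym.
exists (size s), (fun j => HB.pack_for {linear V -> V} (q j)
   (GRing.isLinear.Build K V V *:%R (q j) (qlin j))), m.
split=> //.
- split=> [v|i j v] /=; first by rewrite -split_n hP.1.
  (* P_k with n k = m j lies in the j-th block, hence Q_i fixes its image or
     kills it. *)
  have qP k : n k == m j -> q i (P k v) = if i == j then P k v else 0.
    move=> /eqP nk; rewrite /q.
    under eq_bigr do rewrite hP.2.
    rewrite -big_mkcondr /=; case: eqP => [->|ij].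
      rewrite (big_pred1 k) // => l /=.
      by rewrite andbC; case: eqP => // ->; rewrite nk eqxx.
    rewrite big_pred0 // => l; apply/negP => /andP[/eqP nl /eqP lk].
    by apply: ij; apply: m_inj; rewrite -nl lk.
  have -> : q i (q j v) = \sum_(k | n k == m j) q i (P k v).
    rewrite /q exchange_big /=; apply: eq_bigr => k _; exact: raddf_sum.
  rewrite (eq_bigr _ qP); case: eqP => // _; exact: big1_eq.
- move=> j; have : m j \in s by exact: mem_tnth.
  by rewrite mem_undup => /codomP[i ->]; exists i.
move=> c v; rewrite split_n; apply: eq_bigr => j _ /=.
by rewrite /q scaler_sumr; apply: eq_bigr => i /eqP ->.
Qed.

(** * Diagonal representations *)

Lemma diagonal_rep_exists (K : fieldType) (V : lmodType K) (I : finType)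
    (P : I -> {linear V -> V}) (n : I -> int) :
  projection_system P ->
  exists rho : kstar_rep V, forall a v, rho a v = \sum_i a ^ n i *: P i v.
Proof.
move=> hP; pose g a v := \sum_i a ^ n i *: P i v.
have glin a : linear (g a).
  move=> c u v; rewrite /g scaler_sumr -big_split /=; apply: eq_bigr => i _.
  by rewrite linearP scalerDr !scalerA mulrC.
pose G a : {linear V -> V} := HB.pack_for {linear V -> V} (g a)
   (GRing.isLinear.Build K V V *:%R (g a) (glin a)).
have G1 v : G 1 v = v.
  by rewrite /= -[RHS]hP.1; apply: eq_bigr => i _; rewrite exp1rz scale1r.
have GM a b : a != 0 -> b != 0 -> forall v, G (a * b) v = G a (G b v).
  move=> _ _ v /=; apply: eq_bigr => i _.
  have -> : P i (g b v) = P i (b ^ n i *: v).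
    rewrite -(projection_sum hP (fun j => b ^ n j *: v)); congr (P i _).
    by apply: eq_bigr => j _; rewrite linearZ.
  by rewrite linearZ scalerA expfzMl.
by exists (KstarRep G1 GM).
Qed.

Lemma diagonal_rep_reduced (K : fieldType) (V : lmodType K) (rho : kstar_rep V) r
    (P : 'I_r -> {linear V -> V}) (n : 'I_r -> int) :
  projection_system P -> (forall i, reduced_weight K (n i)) ->
  (forall a v, a != 0 -> rho a v = \sum_i a ^ n i *: P i v) ->
  reduced_rep rho.
Proof.
move=> hP n_red rhoE.
have [s [Q [m [m_inj hQ m_n QE]]]] := merge_projections n hP.
have [a v a0|W hW] := weight_decomposition_of_projections (rho := rho) m_inj hQ.
  by rewrite rhoE // QE.
exists s, W, m; split=> // j; by have [i ->] := m_n j.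
Qed.

(** * Frobenius and restriction of scalars *)

(** As long as m is nonzero and divisible by p, m = m' * p gives
    a ^ m = (a ^ m') ^ p, which moves one factor p from the exponent into a
    Frobenius; the absolute value of the exponent decreases strictly.  In
    characteristic 0, and for m = 0, the weight m is already reduced and f is
    the identity. *)
Lemma character_factorization (K : fieldType) (m : int) :
  exists (f : {rmorphism K -> K}) (n : int),
    reduced_weight K n /\ forall a, f (a ^ n) = a ^ m.
Proof.
have [b] := ubnP `|m|%N; elim: b m => // b IHb m mb.
have [m_red|] := pselect (reduced_weight K m).
  by exists idfun, m.
move=> /existsNP[p /not_implyP[pK /not_implyP[m0 /negP]]].
rewrite negbK => /dvdzP[m' mE].
have p_gt1 : (1 < p)%N by apply: prime_gt1; case/andP: pK.
have m'0 : m' != 0 by apply: contraNneq m0 => m'0; rewrite mE m'0 mul0r.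
have m'b : (`|m'| < b)%N.
  rewrite -ltnS; apply: leq_trans mb; rewrite mE abszM /= ltnS ltn_Pmulr //.
  by rewrite absz_gt0.
have [f [n [n_red fE]]] := IHb _ m'b.
exists (pFrobenius_aut pK \o f : {rmorphism K -> K}), n; split=> // a /=.
by rewrite fE pFrobenius_autE mE -exprz_exp.
Qed.

(** The additive group of U, under a new name so that it can carry a second
    K-module structure.  The parameters [f] and [hP] occur only to let that
    structure be inferred from the type. *)
Definition twist (K : fieldType) (U : lmodType K) (I : finType)
    (P : I -> {linear U -> U}) (f : I -> {rmorphism K -> K})
    (hP : projection_system P) : Type := U.

Section TwistedModule.
Context (K : fieldType) (U : lmodType K) (I : finType).
Context (P : I -> {linear U -> U}) (f : I -> {rmorphism K -> K}).
Context (hP : projection_system P).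

HB.instance Definition _ := GRing.Zmodule.copy (twist f hP) U.

Definition twist_scale (c : K) (v : twist f hP) : twist f hP :=
  \sum_i f i c *: P i v.

(** Each summand is stable under the new scalars, which act on the i-th one
    through [f i]; the module axioms follow from this componentwise. *)
Lemma proj_twist_scale i c v : P i (twist_scale c v) = f i c *: P i v.
Proof.
rewrite /twist_scale -linearZ /= -(projection_sum hP (fun j => f j c *: v)).
by congr (P i _); apply: eq_bigr => j _; rewrite linearZ.
Qed.

Lemma twist_scaleA a b v :
  twist_scale a (twist_scale b v) = twist_scale (a * b) v.
Proof.
rewrite {1}/twist_scale; apply: eq_bigr => i _.
by rewrite proj_twist_scale rmorphM scalerA.
Qed.

Lemma twist_scale1 : left_id 1 twist_scale.
Proof.
move=> v; rewrite /twist_scale -[RHS]hP.1.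
by apply: eq_bigr => i _; rewrite rmorph1 scale1r.
Qed.

Lemma twist_scaleDr : right_distributive twist_scale +%R.
Proof.
move=> c u v; rewrite /twist_scale -big_split.
by apply: eq_bigr => i _; rewrite raddfD scalerDr.
Qed.

Lemma twist_scaleDl v : {morph twist_scale^~ v : a b / a + b}.
Proof.
move=> a b; rewrite /twist_scale -big_split.
by apply: eq_bigr => i _; rewrite rmorphD scalerDl.
Qed.

HB.instance Definition _ := GRing.Zmodule_isLmodule.Build K (twist f hP)
  twist_scaleA twist_scale1 twist_scaleDr twist_scaleDl.

Definition twist_proj (i : I) (v : twist f hP) : twist f hP := P i v.

Lemma twist_proj_linear i : linear (twist_proj i).
Proof.
move=> c u v; rewrite /twist_proj raddfD; congr (_ + _).
rewrite [LHS]proj_twist_scale.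
rewrite /GRing.scale /= /twist_scale (bigD1 i) //= hP.2 eqxx big1 ?addr0 // => j ji.
by rewrite hP.2 (negPf ji) scaler0.
Qed.

HB.instance Definition _ i := GRing.isLinear.Build K (twist f hP) (twist f hP)
  *:%R (twist_proj i) (twist_proj_linear i).

Lemma twist_projection_system :
  projection_system (twist_proj : I -> {linear twist f hP -> twist f hP}).
Proof. by split; [exact: hP.1 | exact: hP.2]. Qed.

(** With c = a ^ n and f i (a ^ n) = a ^ m, this turns the weight m of U into
    the weight n of the twisted module. *)
Lemma twist_scale_proj c i (v : twist f hP) :
  c *: twist_proj i v = f i c *: P i v :> U.
Proof.
rewrite -[LHS](twist_projection_system.1) (bigD1 i) //= big1 ?addr0.
  by rewrite [LHS]proj_twist_scale /twist_proj hP.2 eqxx.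
move=> j ji; rewrite [LHS]proj_twist_scale /twist_proj hP.2.
by rewrite (negPf ji) scaler0.
Qed.

End TwistedModule.

(** * Reduced models *)

Theorem theorem1p17 (K : fieldType)
    (K_countable : countable [set: K]) (K_infinite : infinite_set [set: K])
    (U : lmodType K) (U_countable : countable [set: U])
    (rhoU : kstar_rep U) (U_diag : diagonalizable_rep rhoU) :
  exists (V : lmodType K) (rhoV : kstar_rep V) (Phi : {additive V -> U}),
    reduced_model rhoU rhoV Phi.
Proof.
have [r [W [m /projections_of_weight_decomposition[P [hP rhoE]]]]] := U_diag.
have [f /choice[n fn]] := choice (fun i => character_factorization K (m i)).
pose Q i : {linear twist f hP -> twist f hP} := @twist_proj K U _ P f hP i.
have hQ : projection_system Q := twist_projection_system f hP.
have [rhoV rhoVE] := diagonal_rep_exists n hQ.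
pose idU (v : twist f hP) : U := v.
have idU_additive : zmod_morphism idU by [].
pose Phi : {additive twist f hP -> U} := HB.pack_for {additive twist f hP -> U}
  idU (GRing.isZmodMorphism.Build (twist f hP) U idU idU_additive).
exists (twist f hP), rhoV, Phi; split=> //.
- apply: (diagonal_rep_reduced hQ) => [i|a v _]; last exact: rhoVE.
  by have [] := fn i.
- by exists (idU : U -> twist f hP).
move=> a v a0; rewrite /Phi /= /idU rhoE // rhoVE; apply: eq_bigr => i _.
have [_ <-] := fn i.
exact: twist_scale_proj.
Qed.
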